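(* Let $\mathfrak p$ be a $\emptyset$-stable property (of unordered hypergraphs, or of ordered hypergraphs) that allows $T_0$-filtration, let $m\ge 0$, $n\ge1$ be integers, and let $\alpha_{\mathfrak p}(m,n)$ be the number of all $(m,n)$-hypergraphs having property $\mathfrak p$. Then the number $\beta^\ast_{\mathfrak p}(m,n)$ of all $(m,n)$-hypergraphs that are $T_0$-covers and have property $\mathfrak p$ is $$\beta^\ast_{\mathfrak p}(m,n)=\sum_{i=1}^{n+1}s_{n+1,i}\,\alpha_{\mathfrak p}(m,i-1),$$ where $s_{n,i}$ are the (signed) Stirling numbers of the first kind.
   Context: A (labelled) $(m,n)$-hypergraph $H$ consists of a linearly ordered vertex set $V=\{V[1]<\dots<V[n]\}$ with $n\ge1$ elements together with a finite family of $m$ subsets of $V$, called edges, which may be empty and may repeat. $H$ is ordered if the family is a sequence $(e_1,\dots,e_m)$, and unordered if the family is considered up to re-indexing (a multiset of $m$ subsets of $V$). Two hypergraphs are identified if the order-preserving bijection of their vertex sets carries one family to the other, so one counts $(m,n)$-hypergraphs on a fixed linearly ordered $n$-set. A hypergraph property is a property of such hypergraphs (all ordered, or all unordered), invariant under this identification. For vertices $u,v$ of $H$ write $u\sim_H v$ if every edge of $H$ contains either both or neither of $u,v$. $H$ is a $T_0$-hypergraph if $u\not\sim_H v$ for all distinct vertices $u,v$. A vertex is isolated if it belongs to no edge. $H$ is a cover if it has no isolated vertex; a $T_0$-cover is a cover that is a $T_0$-hypergraph. For a partition $\pi$ of $\{1,\dots,n\}$, $\alpha_{\mathfrak p}(m,n;\pi)$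 is the number of $(m,n)$-hypergraphs $H$ with property $\mathfrak p$ such that $V[i]\sim_H V[j]$ whenever $i,j$ lie in the same class of $\pi$. The property $\mathfrak p$ is a regular $T_0$-property if, for all $m,n$, the value $\alpha_{\mathfrak p}(m,n;\pi)$ depends only on the number $k$ of classes of $\pi$; it is then denoted $\alpha_{\mathfrak p}(m,n;k)$. A regular $T_0$-property $\mathfrak p$ allows $T_0$-filtration if $\alpha_{\mathfrak p}(m,n;k)=\alpha_{\mathfrak p}(m,k)$ for every $k\in\{1,\dots,n\}$ (for all $m,n$). For a hypergraph $H$ with at least one non-isolated vertex, $(H)_0$ denotes the hypergraph obtained from $H$ by deleting all isolated vertices from the vertex set (with the induced linear order) and keeping all edges, including empty ones. The property $\mathfrak p$ is $\emptyset$-stable if for every such $H$: $H$ has property $\mathfrak p$ if and only if $(H)_0$ has property $\mathfrak p$ (i.e. $\mathfrak p$ is invariant under adding and cancelling isolated vertices). Convention for the term $i=1$: $\alpha_{\mathfrak p}(m,0)$ is the number of $(m,1)$-hypergraphs with property $\mathfrak p$ whose unique vertex is isolated (i.e. all $m$ edges are empty). The signed Stirling numbers of the first kind are defined by $x(x-1)\cdots(x-n+1)=\sum_{i=0}^n s_{n,i}x^i$. *)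

(* Defs.v *)
From mathcomp Require Import all_boot all_order all_algebra.

Set Implicit Arguments.
Unset Strict Implicit.
Unset Printing Implicit Defensive.

(* The multisets of cardinality m over a finite type, given by their            *)
(* multiplicity functions; multiplicities are at most m.                        *)
Definition multiset (T : finType) (m : nat) : finType :=
  {f : {ffun T -> 'I_m.+1} | \sum_x f x == m :> nat}.

Section MultisetImage.
Variables (T U : finType) (m : nat) (g : T -> U).
Implicit Type M : multiset T m.

Lemma multiset_image_mult_lt M (y : U) : \sum_(x | g x == y) val M x < m.+1.
Proof.
rewrite ltnS -[leqRHS](eqP (valP M)) [leqRHS](bigID (fun x => g x == y)) /=.
exact: leq_addr.
Qed.

Definition multiset_image_mult M : {ffun U -> 'I_m.+1} :=
  [ffun y => Ordinal (multiset_image_mult_lt M y)].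

Lemma multiset_image_mult_sum M : \sum_y multiset_image_mult M y == m :> nat.
Proof.
rewrite -[eqbRHS](eqP (valP M)) (partition_big g predT) //=.
by apply/eqP/eq_bigr => y _; rewrite ffunE.
Qed.

Definition multiset_image M : multiset U m :=
  exist _ (multiset_image_mult M) (multiset_image_mult_sum M).

End MultisetImage.

Inductive family_kind := Ordered | Unordered.

(* (m, n)-hypergraphs on the vertex set 'I_n with its usual order; every        *)
(* hypergraph on a linearly ordered n-set is identified with exactly one of     *)
(* these. Hypergraphs have n >= 1; the type for n = 0 is never considered.      *)
Definition hypergraph (K : family_kind) (m n : nat) : finType :=
  match K with
  | Ordered => m.-tuple {set 'I_n}
  | Unordered => multiset {set 'I_n} m
  end.

Definition edges (K : family_kind) (m n : nat) :
    hypergraph K m n -> {set {set 'I_n}} :=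
  match K with
  | Ordered => fun H : m.-tuple {set 'I_n} => [set e in H]
  | Unordered => fun H : multiset {set 'I_n} m => [set e | 0 < val H e]
  end.

Definition map_edges (K : family_kind) (m n n' : nat)
    (g : {set 'I_n} -> {set 'I_n'}) : hypergraph K m n -> hypergraph K m n' :=
  match K with
  | Ordered => fun H : m.-tuple {set 'I_n} => map_tuple g H
  | Unordered => fun H : multiset {set 'I_n} m => multiset_image g H
  end.

Section Hypergraph.
Variables (K : family_kind) (m n : nat).
Implicit Types (H : hypergraph K m n) (u v : 'I_n).

Definition sim H u v : bool := [forall e in edges H, (u \in e) == (v \in e)].

Definition is_T0 H : bool := [forall u, forall v, (u != v) ==> ~~ sim H u v].

Definition isolated H v : bool := [forall e in edges H, v \notin e].

Definition is_cover H : bool := [forall v, ~~ isolated H v].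

Definition is_T0_cover H : bool := is_cover H && is_T0 H.

Definition support H : {set 'I_n} := [set v | ~~ isolated H v].

(* (H)_0: enum_val : 'I_#|support H| -> 'I_n is the increasing enumeration of   *)
(* the non-isolated vertices, so it transports the induced linear order.        *)
Definition delete_isolated H : hypergraph K m #|support H| :=
  map_edges (fun e : {set 'I_n} =>
    [set j : 'I_#|support H| | enum_val j \in e]) H.

End Hypergraph.

Definition hypergraph_property (K : family_kind) :=
  forall m n : nat, pred (hypergraph K m n).

Section Property.
Variables (K : family_kind) (p : hypergraph_property K).

(* The value at n = 0 follows the convention: it counts the (m, 1)-hypergraphs  *)
(* with property p whose unique vertex is isolated.                             *)
Definition alpha (m n : nat) : nat :=
  if n is 0 then #|[set H : hypergraph K m 1 | p H && isolated H ord0]|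
  else #|[set H : hypergraph K m n | p H]|.

Definition alpha_part (m n : nat) (pi : {set {set 'I_n}}) : nat :=
  #|[set H : hypergraph K m n | p H &&
      [forall B in pi, forall i in B, forall j in B, sim H i j]]|.

Definition beta_star (m n : nat) : nat :=
  #|[set H : hypergraph K m n | is_T0_cover H && p H]|.

Definition regular_T0_property : Prop :=
  forall (m n : nat), 0 < n ->
  forall pi1 pi2 : {set {set 'I_n}},
    partition pi1 [set: 'I_n] -> partition pi2 [set: 'I_n] ->
    #|pi1| = #|pi2| -> alpha_part m pi1 = alpha_part m pi2.

(* Given regularity, alpha_part m pi is the value denoted alpha(m, n; k), for   *)
(* any partition pi into k classes.                                             *)
Definition allows_T0_filtration : Prop :=
  regular_T0_property /\
  forall (m n k : nat), 0 < k <= n ->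
  forall pi : {set {set 'I_n}}, partition pi [set: 'I_n] -> #|pi| = k ->
    alpha_part m pi = alpha m k.

Definition empty_stable : Prop :=
  forall (m n : nat) (H : hypergraph K m n),
    support H != set0 -> p H = p (delete_isolated H).

End Property.

(* The signed Stirling numbers of the first kind. *)
Definition stirling1 (n i : nat) : int :=
  (\prod_(j < n) ('X - (j%:R)%:P) : {poly int})`_i%R.

(* Main.v *)
(* Equip the "at least these vertices coincide" counts with the umbra
   x^k -> alpha(k).  Forcing a set of j vertex classes, out of k, to be
   pairwise inequivalent is done one class at a time: a new class either stays
   apart from the previous j ones, or is merged with exactly one of them, which
   loses one class.  So each step multiplies by 1 - j/x, and the count becomes
   the image of x(x-1)...(x-j+1) x^(k-j).  With j = k = n this counts the
   T0-hypergraphs.  A T0-hypergraph has at most one isolated vertex, and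
   deleting it leaves a T0-cover, so T0(n) = beta*(n) + n beta*(n-1), which
   matches s(n+1,i+1) = s(n,i) - n s(n,i+1). *)
Require Import Defs.
From mathcomp Require Import all_boot all_order all_algebra.
From mathcomp Require Import ring.

Set Implicit Arguments.
Unset Strict Implicit.
Unset Printing Implicit Defensive.

Import GRing.Theory.

(** * Partitions as fibres of maps, and the sieve separating their classes *)

Lemma card_preim_partition (T T' : finType) (f : T -> T') (D : {set T}) :
  #|preim_partition f D| = #|f @: D|.
Proof.
pose h y := [set x in D | f x == y].
have -> : preim_partition f D = h @: (f @: D).
  rewrite -imset_comp; apply: eq_in_imset => x xD.
  by apply/setP=> y; rewrite !inE eq_sym.
apply: card_in_imset => _ _ /imsetP[x xD ->] /imsetP[y yD ->] /setP/(_ x).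
by rewrite !inE xD eqxx /= => /esym/eqP.
Qed.

Section KernelSieve.
Variable T : finType.
Implicit Types (f : T -> T) (s : seq T) (e : rel T).

(** A map [f] encodes the partition of [T] into its fibres, each class being named by its value
    under [f]. Merging two classes is then a relabelling of values. *)
Definition compatible f e : bool := [forall x, forall y, (f x == f y) ==> e x y].

Definition separates f s e : bool :=
  [forall x, forall y, [&& f x \in s, f y \in s & f x != f y] ==> ~~ e x y].

(** This interpolates between [compatible f e], when [s] is empty, and discreteness of a reflexive
    [e], when [f] is the identity and [s] lists [T]. *)
Definition sieved f s e : bool := compatible f e && separates f s e.

Definition merge (a b : T) f : T -> T := fun x => if f x == a then b else f x.

Lemma compatibleP f e :
  reflect (forall x y, f x = f y -> e x y) (compatible f e).
Proof.
apply: (iffP forallP) => [fe x y /eqP fxy | fe x].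
  by have /forallP/(_ y) := fe x; rewrite fxy.
by apply/forallP=> y; apply/implyP=> /eqP; apply: fe.
Qed.

Lemma separatesP f s e :
  reflect (forall x y, f x \in s -> f y \in s -> e x y -> f x = f y)
          (separates f s e).
Proof.
apply: (iffP forallP) => [fe x y sx sy exy | fe x].
  have /forallP/(_ y) := fe x; rewrite sx sy exy /= implybF negbK.
  exact: eqP.
apply/forallP=> y; apply/implyP=> /and3P[sx sy]; apply: contra => exy.
exact/eqP/fe.
Qed.

Lemma mergeE_notin a b s f x :
  a \notin s -> f x \in s -> merge a b f x = f x.
Proof. by rewrite /merge; case: eqP => // -> /negPf->. Qed.

Lemma imset_merge a b f :
  b \in f @: T -> a != b -> merge a b f @: T = (f @: T) :\ a.
Proof.
move=> /imsetP[y _ def_b] neq_ab; apply/setP=> z; rewrite in_setD1.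
apply/imsetP/andP=> [[x _ ->] | [neq_za /imsetP[x _ def_z]]].
  rewrite /merge; case: ifPn => [_ | neq_fxa].
    by rewrite eq_sym neq_ab def_b imset_f.
  by rewrite neq_fxa imset_f.
by exists x; rewrite // /merge -def_z (negPf neq_za).
Qed.

(* Uniqueness of b in the sum: two such b would be equivalent to a, hence to
   each other, while s is separated. *)
Lemma sieved_cons a s f e :
    reflexive e -> symmetric e -> transitive e ->
    uniq (a :: s) -> {subset a :: s <= f @: T} ->
  (sieved f s e = sieved f (a :: s) e + \sum_(b <- s) sieved (merge a b f) s e
    :> nat)%N.
Proof.
move=> e_refl e_sym e_trans /=/andP[s'a uniq_s] sub_sf.
have sub_s : {subset s <= f @: T} by move=> b sb; rewrite sub_sf // inE sb orbT.
have [z _ def_a] := imsetP (sub_sf a (mem_head a s)).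
have merge_z b : b \in s -> forall y, f y = b -> merge a b f z = merge a b f y.
  by move=> sb y fy; rewrite (mergeE_notin (x := y) b s'a) ?fy // /merge -def_a eqxx.
case: (boolP (sieved f s e)) => [/andP[/compatibleP fe /separatesP fs] | notS].
  (* The point [z] represents the class [a]. Either that class is equivalent to a class in [s], and
     only the merge with it survives, or it is apart from all of them, and only the first term
     does. *)
  case: (boolP [exists y, (f y \in s) && e z y]) => [/existsP[w /andP[sw ezw]] | noE].
    have neq_aw : a != f w by apply: contraNneq s'a => ->.
    (* The merge relabels the class [a] as the equivalent class of [w], so every new label is the
       old label of an equivalent point. Both conditions thus reduce to those for [f]. *)
    have liftx x : exists2 x', f x' = merge a (f w) f x & e x x'.
      rewrite /merge; case: eqP => [fxa | _]; last by exists x.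
      by exists w; rewrite // (e_trans z) // fe // fxa.
    have -> : sieved f (a :: s) e = false.
      apply/negP=> /andP[_ /separatesP/(_ z w)].
      rewrite -def_a mem_head inE sw orbT => /(_ isT isT ezw) eq_aw.
      by rewrite eq_aw eqxx in neq_aw.
    rewrite (bigD1_seq (f w)) //= big1_seq => [|b /andP[neq_b sb]].
      suff -> : sieved (merge a (f w) f) s e by [].
      apply/andP; split; [apply/compatibleP=> x y | apply/separatesP=> x y].
        have [[x' <- exx'] [y' <- eyy']] := (liftx x, liftx y).
        by move/fe=> exy; rewrite (e_trans x') // (e_trans y') // e_sym.
      have [[x' <- exx'] [y' <- eyy']] := (liftx x, liftx y).
      move=> sx sy exy; apply: fs => //; rewrite (e_trans x) // 1?e_sym //.
      by rewrite e_sym (e_trans y).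
    apply/eqP; rewrite eqb0; apply: contra neq_b => /andP[/compatibleP fbe _].
    have [y _ def_b] := imsetP (sub_s b sb).
    rewrite def_b; apply/eqP/fs => //; first by rewrite -def_b.
    rewrite (e_trans z) // e_sym; apply: fbe; exact: merge_z.
  have -> : sieved f (a :: s) e.
    apply/andP; split; first exact/compatibleP.
    have notE x y : f x = a -> f y \in s -> e x y = false.
      move=> fx sy; apply: contraNF noE => exy; apply/existsP; exists y.
      by rewrite sy (e_trans x) // fe // fx.
    apply/separatesP=> x y; rewrite !inE.
    case/predU1P=> [fx | sx] /predU1P[fy | sy]; first by rewrite fx fy.
    - by rewrite notE.
    - by rewrite e_sym notE.
    exact: fs.
  rewrite big1_seq // => b /= sb; apply/eqP; rewrite eqb0.
  apply: contra noE => /andP[/compatibleP fbe _].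
  have [y _ def_b] := imsetP (sub_s b sb).
  by apply/existsP; exists y; rewrite -def_b sb fbe //; apply: merge_z.
(* When the left side is 0, so is the right: each of its conditions implies [sieved f s e], because
   a merge coarsens the partition and leaves the labels in [s] unchanged. *)
have -> : sieved f (a :: s) e = false.
  apply: contraNF notS => /andP[fe /separatesP fs]; rewrite /sieved fe.
  by apply/separatesP=> x y sx sy; apply: fs; rewrite inE ?sx ?sy orbT.
rewrite big1_seq // => b /= sb; apply/eqP; rewrite eqb0.
apply: contra notS => /andP[/compatibleP fe /separatesP fs].
apply/andP; split; [apply/compatibleP=> x y fxy|apply/separatesP=> x y sx sy exy].
  by apply: fe; rewrite /merge fxy.
by have := fs x y; rewrite (mergeE_notin b s'a sx) (mergeE_notin b s'a sy); apply.
Qed.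

(** Brings compatibility into the form of the condition used in [alpha_part]. *)
Lemma compatible_partition f e :
  compatible f e = [forall B in preim_partition f setT,
                    forall i in B, forall j in B, e i j].
Proof.
apply/compatibleP/forall_inP => [fe B | fe x y fxy].
  case/imsetP=> x _ ->; apply/forall_inP=> i; rewrite inE => /andP[_ /eqP fi].
  apply/forall_inP=> j; rewrite inE => /andP[_ /eqP fj].
  by apply: fe; rewrite -fi.
have /forall_inP/(_ x) := fe _ (imset_f _ (in_setT x)).
rewrite !inE eqxx => /(_ isT)/forall_inP/(_ y); rewrite !inE fxy eqxx; exact.
Qed.

End KernelSieve.

(** * Umbral evaluation and the falling factorial *)

Lemma sum_coefXn (a : nat -> int) N k :
  (k < N)%N -> (\sum_(i < N) ('X^k)`_i * a i)%R = a k.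
Proof.
move=> ltkN; rewrite (bigD1 (Ordinal ltkN)) //= coefXn eqxx mul1r big1 ?addr0 //.
move=> i neq_ik; rewrite coefXn; case: eqP => [eq_ik|_]; last by rewrite mul0r.
by rewrite -val_eqE /= eq_ik eqxx in neq_ik.
Qed.

Section DiscreteCount.
Variables (T X : finType) (P : pred X) (r : X -> rel T) (a : nat -> int).
Hypothesis r_refl : forall x, reflexive (r x).
Hypothesis r_sym : forall x, symmetric (r x).
Hypothesis r_trans : forall x, transitive (r x).
Hypothesis count_compatible : forall f : T -> T,
  ((\sum_(x | P x) compatible f (r x))%N%:Z = a #|f @: T|)%R.

(** The umbra: the linear functional with ['X^k] sent to [a k]. Truncation at [#|T|] is harmless,
    since the polynomials below have degree [#|f @: T|]. *)
Let L (q : {poly int}) : int := (\sum_(i < #|T|.+1) q`_i * a i)%R.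

(** Induction on [s] for all [f] at once, because [sieved_cons] replaces [f] by its merges. *)
Lemma count_sieved s (f : T -> T) : uniq s -> {subset s <= f @: T} ->
  ((\sum_(x | P x) sieved f s (r x))%N%:Z =
   L (\prod_(j < size s) ('X - (j%:R)%:P) * 'X^(#|f @: T| - size s)))%R.
Proof.
have L_sub q q' : L (q - q')%R = (L q - L q')%R.
  by rewrite /L -sumrB; apply: eq_bigr => i _; rewrite coefB mulrBl.
have L_mul c q : L (c%:P * q)%R = (c * L q)%R.
  by rewrite /L mulr_sumr; apply: eq_bigr => i _; rewrite coefCM mulrA.
elim: s f => [|b s IHs] f uniq_s sub_sf.
  rewrite big_ord0 mul1r subn0 /L sum_coefXn.
    rewrite -count_compatible; congr Posz; apply: eq_bigr => x _.
    rewrite /sieved andbC; case: separatesP => //=; case=> y z.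
    by rewrite in_nil.
  by rewrite ltnS max_card.
have [s'b uniq_s'] := andP uniq_s.
have sub_s : {subset s <= f @: T} by move=> c sc; rewrite sub_sf // inE sc orbT.
have card_im : (size s < #|f @: T|)%N.
  rewrite -[(size s).+1]/(size (b :: s)) -(card_uniqP uniq_s).
  by apply/subset_leq_card/subsetP.
have := IHs f uniq_s' sub_s.
under eq_bigr => x _ do rewrite (sieved_cons (r_refl x) (@r_sym x) (@r_trans x) uniq_s sub_sf).
rewrite big_split /= exchange_big /= PoszD => /(canRL (addrK _)) ->.
have -> : ((\sum_(j <- s) \sum_(i | P i) sieved (merge b j f) s (r i))%N%:Z
  = (size s)%:R * L (\prod_(j < size s) ('X - (j%:R)%:P) * 'X^(#|f @: T| - (size s).+1)))%R.
  (* Every merge loses exactly the label [b], so the induction hypothesis gives the same value for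
     each of the [size s] summands. *)
  rewrite (big_morph Posz PoszD (erefl _)) big_seq.
  rewrite (eq_bigr (fun _ => L (\prod_(j < size s) ('X - (j%:R)%:P) * 'X^(#|f @: T| - (size s).+1)))%R).
    by rewrite -big_seq big_const_seq count_predT iter_addr_0 mulr_natl.
  move=> c sc; have fb : b \in f @: T by rewrite sub_sf ?mem_head.
  have neq_bc : b != c by apply: contraNneq s'b => ->.
  rewrite IHs // imset_merge ?(sub_s c) //.
    by rewrite (cardsD1 b (f @: T)) fb add1n subSS.
  move=> d sd; rewrite in_setD1 sub_s // andbT.
  by apply: contraNneq s'b => <-.
rewrite -L_mul -L_sub; congr L.
(* With one ['X] split off the power, the difference of the two terms shows the new factor
   ['X - size s]. *)
rewrite big_ord_recr /= -(subnSK card_im) exprS.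
by ring.
Qed.

(** The case of the identity map with all of [T] separated: no power of ['X] remains, and the
    product is the falling factorial defining [stirling1]. *)
Lemma count_discrete :
  ((\sum_(x | P x) [forall u, forall v, (u != v) ==> ~~ r x u v])%N%:Z =
   \sum_(i < #|T|.+1) stirling1 #|T| i * a i)%R.
Proof.
have im_id : id @: T = [set: T] by apply/setP=> x; rewrite inE; apply/imsetP; exists x.
have := @count_sieved (enum T) id (enum_uniq _).
rewrite im_id cardsT -cardE subnn mulr1 => sieveT.
apply: etrans (sieveT _); last by move=> x; rewrite inE.
congr Posz; apply: eq_bigr => x _; congr nat_of_bool; apply/idP/idP.
  move=> /forallP disc; apply/andP; split.
    by apply/compatibleP=> u v ->; apply: r_refl.
  apply/separatesP=> u v _ _ ruv; have /forallP/(_ v) := disc u.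
  by rewrite ruv implybF negbK => /eqP.
case/andP=> _ /separatesP sep; apply/forallP=> u; apply/forallP=> v.
by apply/implyP; apply: contra => ruv; rewrite (sep u v) ?mem_enum.
Qed.

End DiscreteCount.

(** * Functoriality of the action on edge families *)

Section MapEdges.
Variable K : family_kind.

Lemma map_edges_id m n (g : {set 'I_n} -> {set 'I_n}) (H : hypergraph K m n) :
  g =1 id -> map_edges g H = H.
Proof.
case: K H => H g_id; first by apply/val_inj; rewrite /= (eq_map g_id) map_id.
apply/val_inj/ffunP => e; rewrite ffunE; apply/val_inj => /=.
by rewrite (eq_bigl (pred1 e)) ?big_pred1_eq // => e'; rewrite g_id.
Qed.

Lemma map_edges_eq m n n' (g h : {set 'I_n} -> {set 'I_n'}) (H : hypergraph K m n) :
  {in edges H, g =1 h} -> map_edges g H = map_edges h H.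
Proof.
case: K H => H gh.
  by apply/val_inj/eq_in_map => e eH; apply: gh; rewrite inE.
apply/val_inj/ffunP => e; rewrite !ffunE; apply/val_inj => /=.
rewrite big_mkcond [RHS]big_mkcond; apply: eq_bigr => e' _ /=.
have [He' | ] := boolP (0 < val H e'); first by rewrite gh ?inE.
by rewrite -eqn0Ngt => /eqP->; rewrite !if_same.
Qed.

(** The composite enters as [k], equal to it pointwise, so that a simplified form can be supplied
    without function extensionality. *)
Lemma map_edges_comp m n1 n2 n3 (g : {set 'I_n1} -> {set 'I_n2})
    (h : {set 'I_n2} -> {set 'I_n3}) (k : {set 'I_n1} -> {set 'I_n3})
    (H : hypergraph K m n1) :
  h \o g =1 k -> map_edges h (map_edges g H) = map_edges k H.
Proof.
case: K H => H hg; first by apply/val_inj; rewrite /= -map_comp (eq_map hg).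
apply/val_inj/ffunP => e; rewrite !ffunE; apply/val_inj => /=.
(* For multisets, the fibre of the composite over [e] is split according to the intermediate set
   [y]. *)
rewrite (partition_big g (fun y => h y == e)) /= => [|x]; last by rewrite -hg.
apply: eq_bigr => y /eqP hy; rewrite ffunE; apply: eq_bigl => x /=.
by case: eqP => [gx|]; rewrite ?andbF // -hg /= gx hy eqxx.
Qed.

Lemma edges_map m n1 n2 (g : {set 'I_n1} -> {set 'I_n2}) (H : hypergraph K m n1) :
  edges (map_edges g H) = g @: edges H.
Proof.
case: K H => H; apply/setP=> e; rewrite inE /=.
  apply/mapP/imsetP => -[e' e'H ->]; exists e' => //; by rewrite inE in e'H *.
rewrite ffunE /= lt0n sum_nat_eq0 negb_forall.
apply/existsP/imsetP => [[e'] | [e' He' ->]].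
  by rewrite negb_imply => /andP[/eqP <- He']; exists e'; rewrite ?inE ?lt0n.
by exists e'; rewrite inE lt0n in He'; rewrite eqxx.
Qed.

End MapEdges.

(** * Similarity of vertices and isolated vertices *)

Lemma isolatedP K m n (H : hypergraph K m n) v :
  reflect (forall e, e \in edges H -> v \notin e) (isolated H v).
Proof. exact: forall_inP. Qed.

Lemma sim_refl K m n (H : hypergraph K m n) : reflexive (sim H).
Proof. by move=> u; apply/forall_inP. Qed.

Lemma sim_sym K m n (H : hypergraph K m n) : symmetric (sim H).
Proof. by move=> u v; apply: eq_forallb => e; rewrite eq_sym. Qed.

Lemma sim_trans K m n (H : hypergraph K m n) : transitive (sim H).
Proof.
move=> v u w /forall_inP uv /forall_inP vw; apply/forall_inP=> e He.
by rewrite (eqP (uv e He)) vw.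
Qed.

Lemma sim_isolated K m n (H : hypergraph K m n) u v :
  sim H u v -> isolated H u = isolated H v.
Proof.
move=> /forall_inP uv; apply: eq_forallb_in => e He.
by rewrite (eqP (uv e He)).
Qed.

Lemma T0_isolated_uniq K m n (H : hypergraph K m n) u v :
  is_T0 H -> isolated H u -> isolated H v -> u = v.
Proof.
move=> /forallP/(_ u)/forallP/(_ v) T0 /isolatedP Hu /isolatedP Hv.
apply/eqP; apply: contraTT T0 => neq_uv; rewrite neq_uv negbK /=.
by apply/forall_inP=> e He; rewrite (negPf (Hu e He)) (negPf (Hv e He)).
Qed.

(** * Inserting and deleting one isolated vertex *)

Section AddIsolated.
Variables (K : family_kind) (m n : nat) (v : 'I_n.+1).
Implicit Types (G : hypergraph K m n) (H : hypergraph K m n.+1).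

(** [lift v] is the increasing map that skips [v], so the new vertex sits at position [v] and the
    old ones keep their order. *)
Definition add_isolated G : hypergraph K m n.+1 :=
  map_edges (fun e : {set 'I_n} => lift v @: e) G.

Lemma mem_lift_imset (e : {set 'I_n}) i : (lift v i \in lift v @: e) = (i \in e).
Proof. exact/mem_imset/lift_inj. Qed.

Lemma notin_lift_imset (e : {set 'I_n}) : v \notin lift v @: e.
Proof. by apply/imsetP=> -[i _ /eqP]; apply/negP/neq_lift. Qed.

Lemma sim_add_isolated G i j :
  sim (add_isolated G) (lift v i) (lift v j) = sim G i j.
Proof.
rewrite /sim /add_isolated edges_map; apply/forall_inP/forall_inP => simG e.
  by move=> Ge; have := simG _ (imset_f _ Ge); rewrite !mem_lift_imset.
by case/imsetP=> e' Ge' ->; rewrite !mem_lift_imset; apply: simG.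
Qed.

Lemma isolated_add_isolated G i :
  isolated (add_isolated G) (lift v i) = isolated G i.
Proof.
rewrite /isolated /add_isolated edges_map; apply/forall_inP/forall_inP => isoG e.
  by move=> Ge; have := isoG _ (imset_f _ Ge); rewrite mem_lift_imset.
by case/imsetP=> e' Ge' ->; rewrite mem_lift_imset; apply: isoG.
Qed.

Lemma isolated_new G : isolated (add_isolated G) v.
Proof.
rewrite /isolated /add_isolated edges_map; apply/forall_inP => e.
by case/imsetP=> e' _ ->; apply: notin_lift_imset.
Qed.

Lemma add_isolated_inj : injective add_isolated.
Proof.
apply: (can_inj (g := map_edges (fun e => lift v @^-1: e))) => G.
rewrite (map_edges_comp (k := id)) ?map_edges_id // => e.
by apply/setP=> i; rewrite inE mem_lift_imset.
Qed.

End AddIsolated.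

(** Take for [G] the traces of the edges off [v]. Reinserting [v] turns [e] into [e :\ v], which is
    [e] for an edge avoiding [v]. *)
Lemma isolated_add_isolatedP K m n (H : hypergraph K m n.+1) v :
  isolated H v -> exists G, H = add_isolated v G.
Proof.
move/isolatedP=> vH; exists (map_edges (fun e => lift v @^-1: e) H).
rewrite /add_isolated (map_edges_comp (k := fun e => e :\ v)).
  rewrite (map_edges_eq (h := id)) ?map_edges_id // => e /vH ve.
  by apply/setP=> i; rewrite in_setD1; case: eqP => //= ->; rewrite (negPf ve).
move=> e; apply/setP=> i; rewrite in_setD1.
case: (unliftP v i) => [j ->| ->].
  by rewrite mem_lift_imset inE eq_sym neq_lift.
by rewrite (negPf (notin_lift_imset _ _)) eqxx.
Qed.

(** Reconciles the [enum_val] of [delete_isolated] with the [lift] of [add_isolated]: both list the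
    complement of [v] increasingly, and a strictly sorted list is determined by its elements. *)
Lemma enum_val_setC1 n (v : 'I_n.+1) (S : {set 'I_n.+1}) (nS : #|S| = n) :
  S = [set~ v] -> forall j : 'I_#|S|, enum_val j = lift v (cast_ord nS j).
Proof.
move=> defS j; have ltn_ordK k : sorted (fun x y : 'I_k => x < y) (enum 'I_k).
  by have := iota_ltn_sorted 0 k; rewrite -val_enum_ord sorted_map.
have lt_trans k : transitive (fun x y : 'I_k => x < y).
  by move=> x y z; apply: ltn_trans.
have enumS : enum S = [seq lift v i | i <- enum 'I_n].
  apply: (irr_sorted_eq (leT := fun x y : 'I_n.+1 => x < y)) => //.
  - exact: lt_trans.
  - by move=> x; rewrite /= ltnn.
  - by rewrite [enum S]/enum_mem (sorted_filter (@lt_trans _)) // -enumT.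
  - rewrite sorted_map; apply: sub_sorted (ltn_ordK n) => x y lt_xy.
    by rewrite /= ltnNge leq_bump2 -ltnNge.
  move=> i; rewrite mem_enum defS in_setC1; case: (unliftP v i) => [k ->| ->].
    by rewrite eq_sym neq_lift map_f ?mem_enum.
  by rewrite eqxx; apply/esym/mapP=> -[k _ /eqP]; apply/negP/neq_lift.
rewrite (enum_val_nth (lift v (cast_ord nS j))) enumS.
rewrite (nth_map (cast_ord nS j)) ?size_enum_ord -?[X in _ < X]nS //.
by congr lift; apply/val_inj; rewrite /= nth_enum_ord // -[X in _ < X]nS.
Qed.

(** Handles the vertex count [#|support H|] of [delete_isolated], which is only provably equal to
    [n]. *)
Lemma property_cast K (p : hypergraph_property K) m n k (nk : k = n)
    (G : hypergraph K m n) :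
  p m k (map_edges (fun e : {set 'I_n} => [set j | cast_ord nk j \in e]) G) = p m n G.
Proof.
subst k; rewrite map_edges_id // => e; apply/setP=> j.
by rewrite inE cast_ord_id.
Qed.

Lemma support_add_isolated K m n v (G : hypergraph K m n) :
  is_cover G -> Defs.support (add_isolated v G) = [set~ v].
Proof.
move/forallP=> coverG; apply/setP=> i; rewrite !inE.
case: (unliftP v i) => [j ->| ->]; last by rewrite isolated_new eqxx.
by rewrite isolated_add_isolated coverG eq_sym neq_lift.
Qed.

(** In a cover extended by [v], only [v] is isolated, so [delete_isolated] gives back [G] up to a
    cast. The support is nonempty because [0 < n]. *)
Lemma property_add_isolated K (p : hypergraph_property K) m n v
    (G : hypergraph K m n) :
  empty_stable p -> 0 < n -> is_cover G ->
  p m n.+1 (add_isolated v G) = p m n G.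
Proof.
move=> p_stable n_gt0 /(support_add_isolated v) suppG.
have nS : #|Defs.support (add_isolated v G)| = n.
  by rewrite suppG cardsC1 card_ord.
rewrite p_stable; last by rewrite -card_gt0 nS.
rewrite /delete_isolated /add_isolated -(property_cast p nS).
congr (p _ _ _); apply: map_edges_comp => e; apply/setP=> j.
by rewrite !inE (enum_val_setC1 nS suppG) mem_lift_imset.
Qed.

(** An isolated vertex of [G] would be similar to [v]; conversely a covered vertex never is. *)
Lemma is_T0_add_isolated K m n v (G : hypergraph K m n) :
  is_T0 (add_isolated v G) = is_T0_cover G.
Proof.
apply/idP/andP => [T0 | [/forallP coverG /forallP T0]].
  split; apply/forallP=> i.
    apply/negP; rewrite -(isolated_add_isolated v) => Hi.
    by have /eqP := T0_isolated_uniq T0 Hi (isolated_new v G); rewrite eq_sym; apply/negP/neq_lift.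
  apply/forallP=> j; apply/implyP=> neq_ij.
  have /forallP/(_ (lift v i))/forallP/(_ (lift v j)) := T0.
  by rewrite (inj_eq lift_inj) neq_ij sim_add_isolated.
have notsim j : ~~ sim (add_isolated v G) v (lift v j).
  apply/negP=> /sim_isolated; rewrite isolated_new isolated_add_isolated.
  by rewrite (negPf (coverG j)).
apply/forallP=> x; apply/forallP=> y; apply/implyP.
case: (unliftP v x) => [i ->| ->]; case: (unliftP v y) => [j ->| ->] //.
- rewrite (inj_eq lift_inj) sim_add_isolated => neq_ij.
  by have /forallP/(_ j)/implyP/(_ neq_ij) := T0 i.
- by rewrite sim_sym.
by rewrite eqxx.
Qed.

(** * Recurrence and vanishing of the Stirling numbers *)

Lemma stirling1S n i :
  (stirling1 n.+1 i.+1 = stirling1 n i - n%:R * stirling1 n i.+1)%R.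
Proof.
by rewrite /stirling1 big_ord_recr /= mulrBr coefB coefMX coefMC mulrC.
Qed.

Lemma stirling1_gt n i : (n < i)%N -> stirling1 n i = 0%R.
Proof.
move=> lt_ni; apply/nth_default; apply: leq_trans lt_ni.
rewrite (size_prod_XsubC _ (fun j : 'I_n => j%:R%R)).
by rewrite /index_enum -enumT size_enum_ord.
Qed.

(** * Counting T0-hypergraphs and T0-covers *)

Section Counting.
Variables (K : family_kind) (p : hypergraph_property K).
Hypotheses (p_stable : empty_stable p) (p_filtration : allows_T0_filtration p).

Definition T0_count m n := #|[set H : hypergraph K m n | is_T0 H && p H]|.

Lemma T0_count_stirling m n : 0 < n ->
  ((T0_count m n)%:Z = \sum_(i < n.+1) stirling1 n i * (alpha p m i)%:Z)%R.
Proof.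
move=> n_gt0; have [_ alphaE] := p_filtration.
have := @count_discrete 'I_n (hypergraph K m n) (@p m n) (@sim K m n)
  (fun i => (alpha p m i)%:Z)%R (@sim_refl K m n) (@sim_sym K m n) (@sim_trans K m n).
rewrite card_ord => <- => [|f].
  rewrite /T0_count -sum1dep_card; congr Posz.
  by rewrite big_mkcondl; apply: eq_bigr => H _; rewrite /is_T0; case: ifP.
rewrite -(alphaE _ n _ _ (preim_partition f setT)) ?preim_partitionP //; first last.
- rewrite card_preim_partition; apply: eq_card => i.
  by apply/imsetP/imsetP=> -[x _ ->]; exists x; rewrite ?inE.
(* The filtration hypothesis starts at one class; the image is nonempty since [0 < n]. *)
- have := max_card (f @: 'I_n); rewrite card_ord => ->; rewrite andbT card_gt0.
  by apply/set0Pn; exists (f (Ordinal n_gt0)); rewrite imset_f.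
congr Posz; rewrite /alpha_part -sum1dep_card big_mkcondr.
by apply: eq_bigr => H _; rewrite compatible_partition; case: ifP.
Qed.

Lemma card_T0_isolated m n v : 0 < n ->
  #|[set H : hypergraph K m n.+1 | [&& is_T0 H, p H & isolated H v]]|
  = beta_star p m n.
Proof.
move=> n_gt0; rewrite /beta_star -(card_imset _ (@add_isolated_inj K m n v)).
apply: eq_card => H; rewrite inE; apply/and3P/imsetP => [[T0 pH Hv] | [G]].
  have [G defH] := isolated_add_isolatedP Hv; exists G => //.
  move: T0 pH; rewrite inE defH is_T0_add_isolated => T0G.
  by rewrite T0G property_add_isolated //; case/andP: T0G.
rewrite inE => /andP[T0G pG] ->.
rewrite is_T0_add_isolated isolated_new property_add_isolated //.
by case/andP: T0G.
Qed.

(* At n = 1 the convention for alpha(m, 0) plays the role of beta*(m, 0). *)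
Lemma T0_count_split m n : 0 < n ->
  T0_count m n = beta_star p m n +
    n * (if n == 1 then alpha p m 0 else beta_star p m n.-1).
Proof.
case: n => // n _; rewrite /T0_count.
have -> : n.+1 * (if n.+1 == 1 then alpha p m 0 else beta_star p m n) =
    \sum_(v < n.+1) #|[set H : hypergraph K m n.+1 | [&& is_T0 H, p H & isolated H v]]|.
  case: n => [|n].
    rewrite big_ord1 mul1n /alpha; apply: eq_card => H; rewrite !inE.
    suff -> : is_T0 H by [].
    by apply/forallP=> u; apply/forallP=> v; rewrite !ord1.
  rewrite (eq_bigr (fun _ => beta_star p m n.+1)).
    by rewrite sum_nat_const card_ord.
  by move=> v _; apply: card_T0_isolated.
rewrite /beta_star -!sum1dep_card.
under [X in _ = _ + X]eq_bigr => v _ do rewrite -sum1dep_card.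
(* Double counting of pairs [(H, v)] with [v] isolated in [H]: each T0-hypergraph that is not a
   cover has exactly one such [v]. *)
rewrite (exchange_big_dep (fun H => is_T0 H && p H)) /=; last first.
  by move=> v H _ /and3P[-> ->].
rewrite big_mkcond [X in _ = X + _]big_mkcond [X in _ = _ + X]big_mkcond.
rewrite -big_split; apply: eq_bigr => H _ /=; rewrite /is_T0_cover.
case: ifP => [/andP[T0 pH] | notT0p]; last first.
  by case: (is_cover H) => //=; rewrite notT0p.
rewrite T0 pH !andbT /=.
case: (boolP (is_cover H)) => [/forallP cH | /forallPn[v]].
  by rewrite big1 // => v; rewrite (negPf (cH v)).
rewrite negbK => Hv; rewrite (bigD1 v) //= big1 // => w /andP[Hw].
by rewrite (T0_isolated_uniq T0 Hw Hv) eqxx.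
Qed.

Lemma beta_star_stirling m n : 0 < n ->
  ((beta_star p m n)%:Z =
   \sum_(i < n.+1) stirling1 n.+1 i.+1 * (alpha p m i)%:Z)%R.
Proof.
elim: n => // n IHn _.
have -> : ((beta_star p m n.+1)%:Z = (T0_count m n.+1)%:Z -
    n.+1%:R * \sum_(i < n.+1) stirling1 n.+1 i.+1 * (alpha p m i)%:Z)%R.
  rewrite (T0_count_split m (ltn0Sn n)) PoszD PoszM; case: n IHn => [_|n IHn].
    (* For one vertex the sum is the single term [alpha p m 0], as [stirling1 1 1] is 1. *)
    rewrite /= big_ord1 /stirling1 big_ord1 coefB coefX coefC /= subr0 !mul1r.
    by rewrite addrK.
  by rewrite -IHn // natz addrK.
rewrite T0_count_stirling //.
under [RHS]eq_bigr => i _ do rewrite stirling1S mulrBl -mulrA.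
rewrite sumrB -mulr_sumr; congr (_ - _ * _)%R.
(* The second sum runs one index further, where [stirling1 n.+1 n.+2] vanishes. *)
by rewrite [RHS]big_ord_recr /= stirling1_gt // mul0r addr0.
Qed.

End Counting.

Theorem theorem4p2 (K : family_kind) (p : hypergraph_property K) (m n : nat)
    (p_stable : empty_stable p) (p_filtration : allows_T0_filtration p)
    (n_ge1 : 1 <= n) :
  (beta_star p m n)%:Z%R =
  (\sum_(1 <= i < n.+2) stirling1 n.+1 i * (alpha p m i.-1)%:Z)%R.
Proof.
by rewrite beta_star_stirling // big_add1 big_mkord.
Qed.
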